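(* Let $S(s,t;z)=\sum_{n\ge1}\sum_{\pi\in\mathfrak S_n(2413,4213)}s^{\mathrm{ides}(\pi)}t^{\mathrm{des}(\pi)}z^n$. Then, as formal power series in $z$, $$S(s,t;z)=t\big(z(s-1)+1\big)S(s,t;z)^3+tz(2s-1)S(s,t;z)^2+z(ts+1)S(s,t;z)+z.$$ In particular $S(1,t;z)=tS(1,t;z)^3+tzS(1,t;z)^2+z(t+1)S(1,t;z)+z$ and $S(s,1;z)=(sz-z+1)S(s,1;z)^2+szS(s,1;z)+z$.
   Context: $\mathfrak S_n(2413,4213)$ is the set of permutations of $[n]$ avoiding the patterns $2413$ and $4213$ (no subsequence order isomorphic to either). $\mathrm{des}(\pi)=|\{i\in[n-1]:\pi_i>\pi_{i+1}\}|$ and $\mathrm{ides}(\pi)=\mathrm{des}(\pi^{-1})$. *)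

(* Defs.v *)
From HB Require Import structures.
From mathcomp Require Import all_boot all_order all_algebra all_fingroup.
Set Implicit Arguments. Unset Strict Implicit. Unset Printing Implicit Defensive.
Import GRing.Theory.

(* A pattern is given as a one-line word [p_1; ...; p_k] of a permutation
   of [k]. pi : {perm 'I_n} contains p if there is a strictly increasing
   f : 'I_k -> 'I_n with pi(f a) < pi(f b) <-> p_a < p_b. *)
Definition contains_pattern (n : nat) (pi : {perm 'I_n}) (p : seq nat) : bool :=
  [exists f : {ffun 'I_(size p) -> 'I_n},
    [forall a : 'I_(size p), forall b : 'I_(size p),
      ((a < b)%N ==> (f a < f b)%N) &&
      ((pi (f a) < pi (f b))%N == (nth 0 p a < nth 0 p b)%N)]].

Definition avoids (n : nat) (pi : {perm 'I_n}) (p : seq nat) : bool :=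
  ~~ contains_pattern pi p.

Definition des (n : nat) (pi : {perm 'I_n}) : nat :=
  #|[set i : 'I_n | [exists j : 'I_n, (val j == (val i).+1) && (pi j < pi i)%N]]|.

Definition ides (n : nat) (pi : {perm 'I_n}) : nat := des pi^-1.

Definition avoids_2413_4213b (n : nat) (pi : {perm 'I_n}) : bool :=
  avoids pi [:: 2; 4; 1; 3] && avoids pi [:: 4; 2; 1; 3].

Definition Scoef (R : comNzRingType) (s t : R) (n : nat) : R :=
  if n == 0%N then 0%R else
  (\sum_(pi : {perm 'I_n} | avoids_2413_4213b pi)
     s ^+ ides pi * t ^+ des pi)%R.

(* Formal power series in z represented by coefficient sequences. *)
Definition fps_mul (R : comNzRingType) (a b : nat -> R) (n : nat) : R :=
  (\sum_(i < n.+1) a i * b (n - i)%N)%R.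

Definition fps_z (R : comNzRingType) (a : nat -> R) (n : nat) : R :=
  if n is m.+1 then a m else 0%R.

Definition fps_zvar (R : comNzRingType) (n : nat) : R := if n == 1%N then 1%R else 0%R.

(* Main.v *)
Require Import Defs.
From HB Require Import structures.
From mathcomp Require Import all_boot all_order all_algebra all_fingroup.
From mathcomp Require Import zify ring.
Import GRing.Theory.
Set Implicit Arguments.
Unset Strict Implicit.
Unset Printing Implicit Defensive.

(* Split an avoiding permutation word at its least letter as L 0 R. If L is not
   empty, its letters form an interval of values (a missing value would occur in R
   and play the 3 with 0 as the 1), L is an arbitrary avoider, and R is an avoider
   with a cut in its values, at the height of L, such that R still avoids both
   patterns when a letter at that height is put in front. A nonempty word with such
   a cut above its least letter splits at that letter into two arbitrary words with
   cuts. If B counts the words with a cut (the pair of values around the cut being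
   ignored by ides), this gives
     S = z (1 + S + s t S B),
     B = 1 + S + z (1 + t S + s t (B - 1 - S)) B.
   The difference D = B (1 - t S^2) - (1 + S)^2 then satisfies D = z K D for some
   series K, so D = 0, and eliminating B yields the cubic. *)

(** * Words with a cut *)

(* [w] avoids 2413 and 4213, and still does when a letter lying strictly between
   the values [c - 1] and [c] is put in front of it. *)
Definition cut_avoiding (c : nat) (w : seq nat) : bool :=
  all (fun d => all (fun x =>
    ~~ [&& x < d, index x w < index d w,
        has (fun a => (x < a < d) && (index a w < index x w)) w
          || (x < c <= d) &
        has (fun b => (d < b) && (index b w < index x w)) w || (d < c)]) w) w.

(** Here [x] plays the 1, [a] the 2, [d] the 3 and [b] the 4. The order of [a] and [b] is left free,
    which merges both patterns. In the last two clauses the letter put in front plays the 4, then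
    the 2. *)
Lemma cut_avoidingP c w :
  reflect [/\ forall a b x d, x < a -> a < d -> d < b ->
                index a w < index x w -> index b w < index x w ->
                index x w < index d w -> index d w < size w -> False,
              forall a x d, x < a -> a < d -> d < c ->
                index a w < index x w -> index x w < index d w ->
                index d w < size w -> False
            & forall b x d, x < c -> c <= d -> d < b ->
                index b w < index x w -> index x w < index d w ->
                index d w < size w -> False]
          (cut_avoiding c w).
Proof.
apply: (iffP idP) => [/allP H | [H1 H2 H3]].
  have key x d : index x w < index d w -> index d w < size w -> x < d ->
    (exists2 a, x < a < d & index a w < index x w) \/ (x < c <= d) ->
    (exists2 b, d < b & index b w < index x w) \/ (d < c) -> False.
    move=> xd dw ltxd lo hi.
    have memw v : index v w < size w -> v \in w by rewrite index_mem.
    have /H/allP/(_ x) : d \in w by apply: memw.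
    have xw : x \in w by apply: memw; apply: ltn_trans dw.
    move/(_ xw)/negP; apply; rewrite ltxd xd /=; apply/andP; split.
      case: lo => [[a a1 a2]|->]; last by rewrite orbT.
      apply/orP; left; apply/hasP; exists a; last by rewrite a1.
      by apply: memw; lia.
    case: hi => [[a a1 a2]|->]; last by rewrite orbT.
    apply/orP; left; apply/hasP; exists a; last by rewrite a1.
    by apply: memw; lia.
  split.
  - move=> a b x d xa ad db ax bx xd dw; apply: (key x d) => //; first lia.
      by left; exists a => //; lia.
    by left; exists b.
  - move=> a x d xa ad dc ax xd dw; apply: (key x d) => //; first lia.
      by left; exists a => //; lia.
    by right.
  - move=> b x d xc cd db bx xd dw; apply: (key x d) => //; first lia.
      by right; lia.
    by left; exists b.
apply/allP => d dw; apply/allP => x xw; apply/negP.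
have {}dw : index d w < size w by rewrite index_mem.
case/and4P => ltxd xd /orP [/hasP[a _ /andP[/andP[xa ad] ax]]|/andP[xc cd]].
  case/orP => [/hasP[b _ /andP[db bx]]|dc]; first exact: (H1 a b x d).
  exact: (H2 a x d).
case/orP => [/hasP[b _ /andP[db bx]]|dc]; first exact: (H3 b x d).
(* The letter in front would have to play the 2 and the 4 at once. *)
lia.
Qed.

(** * Decomposition at the least letter *)

Definition around (r l v : nat) : nat := if v < r then v.+1 else (v + l).+1.

(* The permutation word [L' 0 R'] in which [L'] is [L] shifted to the value interval
   [r+1, r+size L] and [R'] is [R] spread over the remaining positive values. *)
Definition comb (L : seq nat) (r : nat) (R : seq nat) : seq nat :=
  map (addn r.+1) L ++ 0 :: map (around r (size L)) R.

(* How a cut [c] of [comb L r R] induces a cut [cL] of [L], where [l = size L];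
   the induced cut of [R] is [r]. If [c > 0] the values of [L] straddle [c]; if
   [c = 0] the cut of [L] is [0] too, and [r] is normalized to [0] when [L] is
   empty, because [comb] does not depend on it. *)
Definition compat (l r cL c : nat) : bool :=
  (cL <= l) && ((c == (cL + r).+1) ||
                [&& c == 0, cL == 0 & (l == 0) ==> (r == 0)]).

Lemma around_inj r l : injective (around r l).
Proof. rewrite /around => u v; case: ltnP => ? /=; case: ltnP => ? /=; lia. Qed.

Lemma size_comb L r R : size (comb L r R) = (size L + size R).+1.
Proof. by rewrite size_cat /= !size_map addnS. Qed.

Lemma iota_permP n w :
  reflect [/\ uniq w, size w = n & forall v, v \in w -> v < n]
          (perm_eq w (iota 0 n)).
Proof.
apply: (iffP idP) => [H|[Hu Hs Hm]].
  split; first by rewrite (perm_uniq H) iota_uniq.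
    by rewrite (perm_size H) size_iota.
  by move=> v; rewrite (perm_mem H) mem_iota.
have Hsub : {subset w <= iota 0 n} by move=> v /Hm; rewrite mem_iota.
apply: uniq_perm => //; first exact: iota_uniq.
by have [|] := uniq_min_size Hu Hsub; rewrite ?size_iota ?Hs.
Qed.

Lemma iota_perm_mem n w v : perm_eq w (iota 0 n) -> (v \in w) = (v < n).
Proof. by move/perm_mem->; rewrite mem_iota. Qed.

Lemma iota_perm_index n w v :
  perm_eq w (iota 0 n) -> (index v w < n) = (v < n).
Proof.
move=> H; by rewrite -(iota_perm_mem v H) -index_mem (perm_size H) size_iota.
Qed.

Section Comb.
Variables (l m r : nat) (L R : seq nat).
Hypotheses (HL : perm_eq L (iota 0 l)) (HR : perm_eq R (iota 0 m)) (rm : r <= m).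
Local Notation w := (comb L r R).

Let sL : size L = l. Proof. by rewrite (perm_size HL) size_iota. Qed.
Let sR : size R = m. Proof. by rewrite (perm_size HR) size_iota. Qed.

Lemma index_combL u : u < l -> index (r.+1 + u) w = index u L.
Proof.
move=> ul; rewrite index_cat mem_map; last exact: addnI.
by rewrite (@iota_perm_mem l) // ul index_map //; apply: addnI.
Qed.

Lemma index_comb0 : index 0 w = l.
Proof.
rewrite index_cat /= size_map sL addn0; case: ifP => // /mapP[u _].
by rewrite addSn.
Qed.

Lemma index_combR u : u < m -> index (around r l u) w = (l + index u R).+1.
Proof.
move=> um; rewrite index_cat /= size_map sL.
case: ifP => [/mapP[v]|_].
  rewrite (@iota_perm_mem l) // /around => vl; case: ltnP => ? /=; lia.
rewrite ifF; last by rewrite /around; case: ltnP.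
by rewrite index_map ?addnS //; apply: around_inj.
Qed.

(** Locates a value together with its position, in a form that [lia] can use: a letter of [L'], the
    0, or a letter of [R'] below or above the value block of [L']. *)
Variant comb_spec v : nat -> Prop :=
| CombL u of v = r.+1 + u & u < l & index u L < l : comb_spec v (index u L)
| Comb0 of v = 0 : comb_spec v l
| CombRs u of v = u.+1 & u < r & index u R < m :
    comb_spec v (l + index u R).+1
| CombRl u of v = (u + l).+1 & r <= u & u < m & index u R < m :
    comb_spec v (l + index u R).+1.

Lemma combP v : v < (l + m).+1 -> comb_spec v (index v w).
Proof.
move=> vlt.
have [->|v0] := posnP v; first by rewrite index_comb0; constructor.
have [vr|rv] := leqP v r.
  have E : v = around r l v.-1 by rewrite /around; case: ltnP => ? /=; lia.
  rewrite {2}E index_combR; last lia.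
  constructor; first lia; first lia.
  rewrite (@iota_perm_index m) //; lia.
have [vl|lv] := ltnP v (r.+1 + l).
  have E : v = r.+1 + (v - r.+1) by lia.
  rewrite {2}E index_combL; last lia.
  constructor => //; first lia.
  rewrite (@iota_perm_index l) //; lia.
have E : v = around r l (v - l.+1) by rewrite /around; case: ltnP => ? /=; lia.
rewrite {2}E index_combR; last lia.
constructor; [lia|lia|lia|rewrite (@iota_perm_index m) //; lia].
Qed.

Lemma comb_perm : perm_eq w (iota 0 (l + m).+1).
Proof.
apply/iota_permP; split; last 2 first.
- by rewrite size_comb sL sR.
- move=> v; rewrite mem_cat inE => /or3P[/mapP[u]|/eqP->|/mapP[u]] //.
    rewrite (@iota_perm_mem l) //; lia.
  by rewrite (@iota_perm_mem m) // sL /around => um; case: ltnP => ? /=; lia.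
have [uL _ _] := iota_permP _ _ HL.
have [uR _ _] := iota_permP _ _ HR.
rewrite cat_uniq /= (map_inj_uniq (@addnI _)).
rewrite (map_inj_uniq (@around_inj _ _)) uL uR andbT /=.
rewrite negb_or -andbA; apply/and3P; split => //.
- by apply/mapP => -[u]; lia.
- apply/hasPn => v /mapP[u]; rewrite (@iota_perm_mem m) // => um ->.
  apply/mapP => -[z]; rewrite (@iota_perm_mem l) // sL /around => zl; case: ltnP => ? /=; lia.
- by apply/mapP => -[u _]; rewrite /around; case: ltnP.
Qed.

Variables cL c : nat.
Hypothesis Hc : compat l r cL c.

Let sw : size w = (l + m).+1. Proof. by rewrite size_comb sL sR. Qed.

(** A 1 in [L'] or at the 0 cannot go with a 3 in [R']: the 2 and the 4 would be letters of [L'] or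
    the cut letter, and no value of [R'] separates these. If the 1 and the 3 are both in [R'], every
    letter of [L'], and for [c > 0] the cut letter too, acts as a letter at height [r] in front of
    [R]. *)
Lemma cut_avoiding_comb :
  cut_avoiding cL L -> cut_avoiding r R -> cut_avoiding c w.
Proof.
move=> /cut_avoidingP [L1 L2 L3] /cut_avoidingP [R1 R2 R3].
have idxlt v : index v w < (l + m).+1 -> v < (l + m).+1.
  by rewrite (@iota_perm_index (l + m).+1) ?comb_perm.
move: Hc; rewrite /compat => Hc'.
apply/cut_avoidingP; rewrite sw; rewrite sL in L1 L2 L3; rewrite sR in R1 R2 R3; split.
- move=> a b x d xa ad db ax bx xd dn.
  have [ha hb hx hd] : [/\ a < (l+m).+1, b < (l+m).+1, x < (l+m).+1 & d < (l+m).+1].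
    by split; apply: idxlt; lia.
  move: ax bx xd.
  case: (combP hd) => [ud|Ed|ud|ud];
  case: (combP hx) => [ux|Ex|ux|ux]; try lia;
  case: (combP ha) => [ua|Ea|ua|ua]; try lia;
  case: (combP hb) => [ub|Eb|ub|ub]; try lia;
  intros;
  first [ apply: (L1 ua ub ux ud); lia | apply: (R1 ua ub ux ud); lia
        | apply: (R2 ua ux ud); lia | apply: (R3 ub ux ud); lia ].
- move=> a x d xa ad db ax xd dn.
  have [ha hx hd] : [/\ a < (l+m).+1, x < (l+m).+1 & d < (l+m).+1].
    by split; apply: idxlt; lia.
  move: ax xd.
  case: (combP hd) => [ud|Ed|ud|ud];
  case: (combP hx) => [ux|Ex|ux|ux]; try lia;
  case: (combP ha) => [ua|Ea|ua|ua]; try lia;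
  intros;
  first [ apply: (L2 ua ux ud); lia | apply: (R2 ua ux ud); lia ].
- move=> b x d xa ad db bx xd dn.
  have [hb hx hd] : [/\ b < (l+m).+1, x < (l+m).+1 & d < (l+m).+1].
    by split; apply: idxlt; lia.
  move: bx xd.
  case: (combP hd) => [ud|Ed|ud|ud];
  case: (combP hx) => [ux|Ex|ux|ux]; try lia;
  case: (combP hb) => [ub|Eb|ub|ub]; try lia;
  intros;
  first [ apply: (L3 ub ux ud); lia | apply: (R3 ub ux ud); lia ].
Qed.

Lemma cut_avoiding_combV :
  cut_avoiding c w -> cut_avoiding cL L /\ cut_avoiding r R.
Proof.
move=> /cut_avoidingP; rewrite sw => -[W1 W2 W3].
move: Hc; rewrite /compat => Hc'.
have iL v : index v L < l -> v < l by rewrite (@iota_perm_index l).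
have ar v : v < r /\ around r l v = v.+1 \/ r <= v /\ around r l v = (v + l).+1.
  by rewrite /around; case: ltnP => ?; lia.
have iR v : index v R < m -> v < m by rewrite (@iota_perm_index m).
split; apply/cut_avoidingP; rewrite ?sL ?sR; split.
- move=> a b x d xa ad db ax bx xd dn.
  have [ha hb hx hd] : [/\ a < l, b < l, x < l & d < l].
    by split; apply: iL; lia.
  apply: (W1 (r.+1 + a) (r.+1 + b) (r.+1 + x) (r.+1 + d));
    rewrite ?index_combL //; lia.
- move=> a x d xa ad db ax xd dn.
  have [ha hx hd] : [/\ a < l, x < l & d < l] by split; apply: iL; lia.
  apply: (W2 (r.+1 + a) (r.+1 + x) (r.+1 + d)); rewrite ?index_combL //; lia.
- move=> b x d xa ad db bx xd dn.
  have [hb hx hd] : [/\ b < l, x < l & d < l] by split; apply: iL; lia.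
  apply: (W3 (r.+1 + b) (r.+1 + x) (r.+1 + d)); rewrite ?index_combL //; lia.
- move=> a b x d xa ad db ax bx xd dn.
  have [ha hb hx hd] : [/\ a < m, b < m, x < m & d < m].
    by split; apply: iR; lia.
  have := (ar a, ar b, ar x, ar d) => -[[[ara arb] arx] ard].
  apply: (W1 (around r l a) (around r l b) (around r l x) (around r l d));
    rewrite ?index_combR //; lia.
- move=> a x d xa ad dr ax xd dn.
  have [ha hx hd] : [/\ a < m, x < m & d < m] by split; apply: iR; lia.
  have := (ar a, ar x, ar d) => -[[ara arx] ard].
  (* For [c > 0] the cut letter of the whole word serves as the one in front of [R]. For [c = 0] the
     least letter of [L'] does; [L] is not empty because [d < r], while [compat] would force
     [r = 0]. *)
  have [c0|c0] := posnP c.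
    have l0 : 0 < l by lia.
    have i0 : index 0 L < l by rewrite (@iota_perm_index l).
    apply: (W1 (around r l a) (r.+1 + 0) (around r l x) (around r l d));
      rewrite ?index_combR ?index_combL //; lia.
  apply: (W2 (around r l a) (around r l x) (around r l d));
    rewrite ?index_combR //; lia.
- move=> b x d xr rd db bx xd dn.
  have [hb hx hd] : [/\ b < m, x < m & d < m] by split; apply: iR; lia.
  have := (ar b, ar x, ar d) => -[[arb arx] ard].
  have [c0|c0] := posnP c.
    have l0 : 0 < l by lia.
    have i0 : index 0 L < l by rewrite (@iota_perm_index l).
    apply: (W1 (r.+1 + 0) (around r l b) (around r l x) (around r l d));
      rewrite ?index_combR ?index_combL //; lia.
  apply: (W3 (around r l b) (around r l x) (around r l d));
    rewrite ?index_combR //; lia.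
Qed.

End Comb.

Lemma comb_of_interval k L R :
  perm_eq (L ++ 0 :: R) (iota 0 (size L + size R).+1) ->
  (forall v : nat, (v \in L) = (k < v <= k + size L)) -> k <= size R ->
  exists L0 R0, [/\ perm_eq L0 (iota 0 (size L)), perm_eq R0 (iota 0 (size R))
                  & L ++ 0 :: R = comb L0 k R0].
Proof.
set l := size L; set m := size R => Hp HL km.
have [uw _ Hlt] := iota_permP _ _ Hp; move: uw.
rewrite cat_uniq /= negb_or => /and4P[uL /andP[_ /hasPn LR] R0 uR].
have memR (v : nat) : v \in R -> [/\ 0 < v, v < (l + m).+1 & ~~ (k < v <= k + l)].
  move=> vR; split; last by rewrite -HL; apply: LR.
    by case: v vR R0 => // ->.
  by apply: Hlt; rewrite mem_cat inE vR !orbT.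
pose g v := if v <= k then v.-1 else (v - l).-1.
have gP v : (v <= k /\ g v = v.-1) \/ (k < v /\ g v = (v - l).-1).
  by rewrite /g; case: leqP => ?; lia.
have gK : {in R, cancel g (around k l)}.
  move=> v /memR[v0 _ v2]; have gv := gP v; rewrite /around.
  case: ltnP => ?; lia.
have subK : {in L, cancel (subn^~ k.+1) (addn k.+1)}.
  by move=> v; rewrite HL /= => ?; lia.
exists (map (subn^~ k.+1) L), (map g R).
split.
- apply/iota_permP; split; rewrite ?size_map //.
    by rewrite map_inj_in_uniq //; apply: can_in_inj subK.
  by move=> _ /mapP[v + ->]; rewrite HL; lia.
- apply/iota_permP; split; rewrite ?size_map //.
    by rewrite map_inj_in_uniq //; apply: can_in_inj gK.
  by move=> _ /mapP[v /memR[? ? ?] ->]; have := gP v; lia.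
- rewrite /comb size_map -/l -!map_comp; congr (_ ++ _ :: _).
    by rewrite -[LHS]map_id; apply/eq_in_map => v /subK.
  by rewrite -[LHS]map_id; apply/eq_in_map => v /gK.
Qed.

Lemma comb_exists n c w :
  perm_eq w (iota 0 n.+1) -> c <= n.+1 -> cut_avoiding c w ->
  exists l L cL R r,
    [/\ l <= n /\ w = comb L r R, perm_eq L (iota 0 l),
        perm_eq R (iota 0 (n - l)), r <= n - l & compat l r cL c].
Proof.
move=> Hw cn /cut_avoidingP.
have w0 : 0 \in w by rewrite (@iota_perm_mem n.+1).
have [L [R E]] : exists L R : seq nat, w = L ++ 0 :: R.
  by case/splitPr: w0 => L R; exists L, R.
subst w.
have sw := perm_size Hw; rewrite size_cat size_iota /= addnS in sw.
have {sw} sn : n = size L + size R by lia.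
have memw (v : nat) := iota_perm_mem v Hw.
have [uw _ _] := iota_permP _ _ Hw.
move: (uw); rewrite cat_uniq /= negb_or => /and4P[uL /andP[L0 /hasPn LR] R0 uR].
rewrite size_cat /= addnS -sn => -[W1 W2 W3].
set w := L ++ 0 :: R in Hw memw uw W1 W2 W3 *.
have i0 : index 0 w = size L by rewrite index_cat (negPf L0) /= addn0.
have iL (v : nat) : v \in L -> index v w < size L.
  by move=> vL; rewrite index_cat vL index_mem.
have iR (v : nat) : v < n.+1 -> v != 0 -> v \notin L ->
    size L < index v w < n.+1.
  move=> vn v0 vL; rewrite (@iota_perm_index n.+1) // vn andbT.
  by rewrite index_cat (negPf vL) /= eq_sym (negPf v0) addnS ltnS leq_addr.
have Ln (v : nat) : v \in L -> v < n.+1 by move=> vL; rewrite -memw mem_cat vL.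
have Lpos (v : nat) : v \in L -> 0 < v by case: v L0 => // /negPf->.
have [sL|sL] := posnP (size L).
  have LE : L = [::] by apply: size0nil.
  have [L1 [R1 [P1 P2 P3]]] : exists L0 R0,
      [/\ perm_eq L0 (iota 0 (size L)), perm_eq R0 (iota 0 (size R))
        & w = comb L0 c.-1 R0].
    apply: comb_of_interval; rewrite -?sn //; last by clear -cn sn sL; lia.
    by move=> v; rewrite LE /= in_nil; clear; lia.
  (* For [c = 0] the truncated predecessor gives the [r = 0] that [compat] prescribes for an empty
     [L]. *)
  exists 0, L1, 0, R1, c.-1; rewrite subn0 sn sL add0n.
  rewrite sL in P1; split => //; rewrite /compat; clear -cn sn sL; lia.
have exL : exists v : nat, v \in L by exists (nth 0 L 0); apply: mem_nth.
have leL (v : nat) : v \in L -> v <= n by move/Ln.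
case: (ex_minnP exL) => k kL kmin.
case: (ex_maxnP exL leL) => M ML Mmax.
have k0 := Lpos _ kL; have Mn := leL _ ML; have kM := kmin _ ML.
have LE (v : nat) : (v \in L) = (k <= v <= M).
  apply/idP/idP => [vL|/andP[kv vM]]; first by rewrite kmin // Mmax.
  (* A value between two letters of [L] but placed after [0] plays the 3. *)
  case/boolP: (v \in L) => // vL; exfalso.
  have kv' : k < v by rewrite ltn_neqAle kv andbT; apply: contraNneq vL => <-.
  have vM' : v < M by rewrite ltn_neqAle vM andbT; apply: contraNneq vL => ->.
  have vn : v < n.+1 by rewrite ltnS (leq_trans vM).
  have v0 : v != 0 by rewrite -lt0n (leq_trans k0).
  have /andP[iv ivn] := iR v vn v0 vL.
  by apply: (W1 k M 0 v) => //; rewrite i0 ?iL.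
have sLE : size L = (M - k).+1.
  have -> : size L = size (iota k (M - k).+1).
    apply: perm_size; apply: uniq_perm; rewrite ?iota_uniq //.
    by move=> v; rewrite LE mem_iota; clear -kM; lia.
  by rewrite size_iota.
have arith : [/\ k.-1 <= size R, n - size L = size R, size L <= n
               & k + size L = M.+1].
  by clear -sLE sn Mn kM k0; split; lia.
case: arith => kR nL Ln' kLM.
have [L1 [R1 [P1 P2 P3]]] : exists L0 R0,
    [/\ perm_eq L0 (iota 0 (size L)), perm_eq R0 (iota 0 (size R))
      & w = comb L0 k.-1 R0].
  apply: comb_of_interval; rewrite -?sn //.
  by move=> v; rewrite LE; clear -kLM k0; lia.
(* The [k - 1] positive values below the block all go to [R]. For [c = 0] the truncated [c - k] is
   the required 0; otherwise [k <= c <= M + 1] remains to be shown. *)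
exists (size L), L1, (c - k), R1, k.-1; rewrite nL; split => //.
have [c0|c0] := posnP c.
  by rewrite /compat c0; clear -k0 sL; lia.
have notL v : 0 < v -> v <= n -> (v < k) || (M < v) ->
    size L < index v w < n.+1.
  move=> v0 vn vkM; apply: iR; rewrite ?ltnS -?lt0n //.
  by rewrite LE; clear -vkM; lia.
(* If [0 < c < k], then [k - 1] stands after 0 and plays the 3, with the cut letter as the 2, [k] as
   the 4 and 0 as the 1. *)
have kc : k <= c.
  rewrite leqNgt; apply/negP => ck.
  have [? ? ? ck1 k1k] : [/\ 0 < k.-1, k.-1 <= n, (k.-1 < k) || (M < k.-1),
      c <= k.-1 & k.-1 < k] by clear -ck c0 kM Mn; split; lia.
  have /andP[ik ikn] : size L < index k.-1 w < n.+1 by apply: notL.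
  by apply: (W3 k 0 k.-1) => //; rewrite i0 ?iL.
(* If [c > M + 1], then [M + 1] stands after 0 and plays the 3, with [k] as the 2, the cut letter as
   the 4 and 0 as the 1. *)
have cM : c <= M.+1.
  rewrite leqNgt; apply/negP => Mc.
  have [? ? ? kM1] : [/\ 0 < M.+1, M.+1 <= n, (M.+1 < k) || (M < M.+1)
      & k < M.+1] by clear -Mc cn kM; split; lia.
  have /andP[ik ikn] : size L < index M.+1 w < n.+1 by apply: notL.
  by apply: (W2 k 0 M.+1) => //; rewrite i0 ?iL.
by rewrite /compat; clear -kc cM kLM k0; lia.
Qed.

(** The position of 0 determines the length of [L], and the least letter of [L'] determines [r]; an
    empty [L] leaves no trace of [r]. *)
Lemma comb_inj l L r R l' L' r' R' :
  perm_eq L (iota 0 l) -> perm_eq L' (iota 0 l') ->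
  comb L r R = comb L' r' R' ->
  [/\ L = L', R = R' & 0 < l -> r = r'].
Proof.
move=> HL HL' E.
have sL : size L = l by rewrite (perm_size HL) size_iota.
have sL' : size L' = l' by rewrite (perm_size HL') size_iota.
have idx0 S q T : index 0 (comb S q T) = size S.
  rewrite index_cat /= size_map addn0; case: ifP => // /mapP[u _].
  by rewrite addSn.
have ll' : l = l' by rewrite -sL -sL' -(idx0 _ r R) E idx0.
move/eqP: E; rewrite /comb eqseq_cat ?size_map ?sL ?sL' //.
rewrite eqseq_cons eqxx /= => /andP[/eqP E1 /eqP E2].
rewrite -ll' in sL' HL' E2; have [l0|l0] := posnP l.
  move: sL sL' E2; rewrite l0 => /size0nil-> /size0nil-> E2.
  split => //; apply: (inj_map (@around_inj r 0)); rewrite E2.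
  by apply: eq_map => v; rewrite /around addn0 !if_same.
have le S T q q' : perm_eq S (iota 0 l) ->
    map (addn q.+1) S = map (addn q'.+1) T -> q' <= q.
  move=> HS EST; have : q.+1 + 0 \in map (addn q.+1) S.
    by apply: map_f; rewrite (@iota_perm_mem l).
  by rewrite EST => /mapP[u _]; lia.
have rr' : r = r'.
  by apply/eqP; rewrite eqn_leq (le _ _ _ _ HL E1) (le _ _ _ _ HL' (esym E1)).
subst r'; split => //; first exact: (inj_map (@addnI r.+1)).
exact: (inj_map (@around_inj r l)).
Qed.

(** * Descents and inverse descents of a decomposed word *)

(** The default [x] of [head] makes the last letter contribute 0. *)
Fixpoint wdes (w : seq nat) : nat :=
  if w is x :: w' then (head x w' < x) + wdes w' else 0.

(* Inverse descents, the pair of values [c - 1], [c] separated by the cut not being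
   counted. *)
Definition cut_ides (c : nat) (w : seq nat) : nat :=
  count (fun v => [&& 0 < v, v != c & index v w < index v.-1 w]) w.

Lemma wdes_map f w :
  {mono f : x y / x < y} -> wdes (map f w) = wdes w.
Proof.
move=> Hf; elim: w => //= x [|y w] IH; first by rewrite /= !ltnn.
by rewrite IH /= Hf.
Qed.

Lemma wdes_cat0 L R : {in L, forall v, 0 < v} ->
  wdes (L ++ 0 :: R) = (0 < size L) + wdes L + wdes R.
Proof.
elim: L => [|x L IH] //= Hpos; rewrite IH; last first.
  by move=> v vL; apply: Hpos; rewrite inE vL orbT.
case: L {IH} Hpos => [|y L] Hpos /=; last lia.
by rewrite ltnn Hpos ?inE.
Qed.

Lemma wdes_comb L r R :
  wdes (comb L r R) = (0 < size L) + wdes L + wdes R.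
Proof.
rewrite wdes_cat0 ?size_map; last by move=> _ /mapP[u _ ->]; rewrite addSn.
rewrite !wdes_map //; last by move=> x y; rewrite ltn_add2l.
by move=> x y; rewrite /around; case: (ltnP x r) => ?; case: (ltnP y r) => ?; lia.
Qed.

(** Consecutive values stay consecutive except at the borders of the block of [L']. The least letter
    of [L'] stands before the value [r] below it: one more inverse descent, unless [c] separates
    this pair. At the upper border the value of [R'] stands after its predecessor or, when [L] is
    empty, is the cut [c] itself; either way it is not counted, just as the cut [r] of [R]
    demands. *)
Lemma cut_ides_comb (l m r : nat) (L R : seq nat) (cL c : nat) :
  perm_eq L (iota 0 l) -> perm_eq R (iota 0 m) -> r <= m ->
  compat l r cL c ->
  cut_ides c (comb L r R) =
    ((0 < l) && ((c == 0) || (0 < cL))) + cut_ides cL L + cut_ides r R.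
Proof.
move=> HL HR rm; rewrite /compat => Hc.
have sL : size L = l by rewrite (perm_size HL) size_iota.
pose h v := [&& 0 < v, v != c & index v (comb L r R) < index v.-1 (comb L r R)].
pose hL v := [&& 0 < v, v != cL & index v L < index v.-1 L].
pose e := (0 < l) && ((c == 0) || (0 < cL)); rewrite -/e.
have -> : cut_ides c (comb L r R) =
    count (fun v => h (r.+1 + v)) L + count (fun v => h (around r l v)) R.
  by rewrite /cut_ides -/h /comb count_cat /= add0n !count_map sL.
have -> : count (fun v => h (r.+1 + v)) L = e + cut_ides cL L.
  (* The extra inverse descent is charged to the letter 0 of [L], where [hL] is false. *)
  have -> : (e : nat) = count (fun v => e && (v == 0)) L.
    have [e1|_] := boolP e; last by rewrite count_pred0.
    have [uL _ _] := iota_permP _ _ HL.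
    rewrite (count_uniq_mem 0 uL) (@iota_perm_mem l) //; clear -e1; lia.
  rewrite /cut_ides -/hL -count_predUI.
  rewrite [X in _ + X](@eq_count _ _ pred0) ?count_pred0 ?addn0; last first.
    by case=> [|v] /=; rewrite ?andbF.
  apply: eq_in_count => u; rewrite (@iota_perm_mem l) // => ul.
  rewrite /= /h (index_combL r R HL) //.
  have i0 : index 0 L < l by rewrite (@iota_perm_index l) //; lia.
  case: u ul => [|u] ul; last first.
    rewrite addSn /= -[(r + u.+1)]addSnnS (index_combL r R HL) /hL; last lia.
    by rewrite /= andbF /=; clear -Hc ul; lia.
  rewrite addn0 /= /hL /= orbF andbT /e.
  by case: (@combP l m r L R HL HR rm r) => [|v|v|v|v]; lia.
congr (_ + _); rewrite /cut_ides.
apply: eq_in_count => u; rewrite (@iota_perm_mem m) // => um; rewrite /h.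
rewrite (index_combR HL HR rm) //.
(* The predecessor of the image of 0 is the letter 0 or, when [r = 0], the greatest letter of [L']
   if there is one; both stand before [R']. *)
have [->|u0] := posnP u.
  rewrite /around; case: (ltnP 0 r) => r0 /=; first by rewrite (index_comb0 r R HL); lia.
  have i0 : index (r + l) (comb L r R) <= l.
    have [l0|l0] := posnP l.
      have -> : r + l = 0 by lia.
      by rewrite (index_comb0 r R HL).
    have -> : r + l = r.+1 + l.-1 by lia.
    rewrite (index_combL r R HL); last lia.
    by apply: ltnW; rewrite (@iota_perm_index l) //; lia.
  have r00 : r = 0 by lia.
  by move: i0; rewrite r00 add0n; clear; lia.
have [ur|ur] := eqVneq u r.
  have -> : around r l u = (r + l).+1 by rewrite /around; case: ltnP => ?; lia.
  rewrite ur /=; have [l0|l0] := posnP l; first by lia.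
  have -> : r + l = r.+1 + l.-1 by lia.
  rewrite (index_combL r R HL); last lia.
  have : index l.-1 L < l by rewrite (@iota_perm_index l) //; lia.
  lia.
have -> : (around r l u).-1 = around r l u.-1.
  by rewrite /around; case: (ltnP u r) => ?; case: (ltnP u.-1 r) => ?; lia.
have -> : (around r l u != c).
  by apply/eqP; rewrite /around; case: (ltnP u r) => ?; lia.
rewrite (index_combR HL HR rm); last lia.
rewrite /around; case: ifP => _ /=; lia.
Qed.

(** * Counting *)

Definition cutwords (n : nat) : seq (nat * seq nat) :=
  [seq p <- [seq (c, w) | c <- iota 0 n.+1, w <- permutations (iota 0 n)]
     | cut_avoiding p.1 p.2].

Lemma mem_pairs (S T : eqType) (u : seq S) (v : seq T) q :
  (q \in [seq (x, y) | x <- u, y <- v]) = (q.1 \in u) && (q.2 \in v).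
Proof.
apply/allpairsP/andP => [[[x y] [/= ? ? ->]]|[? ?]] //.
by exists q; split=> //; apply: surjective_pairing.
Qed.

Lemma mem_cutwords n p :
  (p \in cutwords n) =
  [&& p.1 <= n, perm_eq p.2 (iota 0 n) & cut_avoiding p.1 p.2].
Proof.
by rewrite mem_filter mem_pairs mem_iota mem_permutations andbC andbA.
Qed.

Lemma cutwords_uniq n : uniq (cutwords n).
Proof.
apply: filter_uniq; apply: allpairs_uniq; rewrite ?iota_uniq ?permutations_uniq //.
by move=> [a b] [c d] _ _ [-> ->].
Qed.

(** [q] holds [(cL, L)] and [(r, R)], and [e] tells whether the resulting cut is positive, which
    separates the two alternatives of [compat]. *)
Definition grow (e : bool) (q : (nat * seq nat) * (nat * seq nat)) :=
  (if e then (q.1.1 + q.2.1).+1 else 0, comb q.1.2 q.2.1 q.2.2).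

Definition growable (e : bool) (l : nat) (q : (nat * seq nat) * (nat * seq nat)) :=
  e || ((q.1.1 == 0) && ((l == 0) ==> (q.2.1 == 0))).

Definition growths (e : bool) (n l : nat) :=
  [seq q <- [seq (x, y) | x <- cutwords l, y <- cutwords (n - l)]
     | growable e l q].

Lemma mem_growths e n l q : (q \in growths e n l) =
  [&& growable e l q, q.1 \in cutwords l & q.2 \in cutwords (n - l)].
Proof.
by rewrite mem_filter mem_pairs.
Qed.

Lemma growths_compat e n l q : q \in growths e n l ->
  compat l q.2.1 q.1.1 (grow e q).1.
Proof.
rewrite mem_growths !mem_cutwords /growable /compat /grow /= => H.
by case: e H => /= H; lia.
Qed.

Lemma cutwords_grow e n :
  perm_eq [seq p <- cutwords n.+1 | (0 < p.1) == e]
          [seq grow e q | l <- iota 0 n.+1, q <- growths e n l].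
Proof.
apply: uniq_perm.
- exact/filter_uniq/cutwords_uniq.
- apply: allpairs_uniq_dep; first exact: iota_uniq.
    move=> l _; apply/filter_uniq/allpairs_uniq; rewrite ?cutwords_uniq //.
    by move=> [a b] [c d] _ _ [-> ->].
  move=> _ _ /allpairsPdep[l [q [_ Hq ->]]] /allpairsPdep[l' [q' [_ Hq' ->]]] /=.
  move: Hq Hq'; rewrite !mem_growths.
  case: q q' => [[cL L] [r R]] [[cL' L'] [r' R']].
  rewrite !mem_cutwords /growable /grow /= => H H' [Hc Hw].
  have P : perm_eq L (iota 0 l) by lia.
  have P' : perm_eq L' (iota 0 l') by lia.
  have [EL ER Hr] := comb_inj P P' Hw.
  have El : l = l'.
    by rewrite -[l](size_iota 0) -(perm_size P) EL (perm_size P') size_iota.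
  subst l' L' R'.
  (* For [e] true, equality of the cuts gives [r] if [L] is empty, since then [cL = 0], and [cL]
     otherwise. For [e] false, [growable] fixes [cL], and also [r] if [L] is empty. *)
  have [Er Ec] : r = r' /\ cL = cL'.
    by case: e H H' Hc => /= H H' Hc; have [l0|/Hr] := posnP l; lia.
  by rewrite Er Ec.
move=> [c w]; rewrite mem_filter mem_cutwords; apply/idP/idP.
  case/and4P; rewrite [(c, w).1]/= [(c, w).2]/= => /eqP ec cn Hw Ha.
  have [l [L [cL [R [r [[ln E] HL HR rm Hc]]]]]] := comb_exists Hw cn Ha.
  rewrite E in Ha.
  have [HaL HaR] := cut_avoiding_combV HL HR rm Hc Ha.
  have Hg : (c, w) = grow e ((cL, L), (r, R)).
    rewrite /grow /= E; congr (_, _); move: Hc; rewrite /compat -ec.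
    by case: posnP => ?; lia.
  apply/allpairsPdep; exists l, ((cL, L), (r, R)); split=> //.
    by rewrite mem_iota; clear -ln; lia.
  rewrite mem_growths !mem_cutwords /= HL HR HaL HaR rm !andbT.
  by move: Hc; rewrite /compat /growable /= -ec; lia.
case/allpairsPdep => l [q []]; rewrite mem_iota => ln Hq Hg.
have Hc := growths_compat Hq.
move: Hq Hc; rewrite mem_growths -Hg /= !mem_cutwords.
case: q Hg => [[cL L] [r R]] /= [Ec Ew] /and3P[He /and3P[cl HL HaL] /and3P[rm HR HaR]] Hc.
have Hp := comb_perm HL HR rm.
rewrite Ew (cut_avoiding_comb HL HR rm Hc) // andbT.
have En : (l + (n - l)).+1 = n.+1 by clear -ln; lia.
rewrite En in Hp; rewrite Hp andbT Ec; case: (e) => /=; lia.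
Qed.

Section Weights.
Variables (A : comNzRingType) (s t : A).
Local Open Scope ring_scope.

Definition weight (p : nat * seq nat) : A :=
  s ^+ cut_ides p.1 p.2 * t ^+ wdes p.2.

Definition Bcoef (n : nat) : A := \sum_(p <- cutwords n) weight p.
(** A front letter below all others can play neither the 2 nor the 4, so the cut 0 imposes nothing:
    these are the coefficients of [1 + S]. *)
Definition Ccoef (n : nat) : A := \sum_(p <- cutwords n | p.1 == 0%N) weight p.

Lemma weight_grow e n l q : q \in growths e n l ->
  weight (grow e q) =
  t ^+ (0 < l)%N * s ^+ ((0 < l) && (~~ e || (0 < q.1.1)))%N
    * (weight q.1 * weight q.2).
Proof.
move=> Hq; have Hc := growths_compat Hq.
move: Hq Hc; rewrite mem_growths !mem_cutwords.
case: q => [[cL L] [r R]] /= /and3P[He /and3P[cl HL HaL] /and3P[rm HR HaR]] Hc.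
rewrite /weight wdes_comb (cut_ides_comb HL HR rm Hc) //.
rewrite (perm_size HL) size_iota.
have -> : ((if e then (cL + r).+1 else 0) == 0)%N = ~~ e by case: (e).
by rewrite !exprD; ring.
Qed.

Lemma sum_growths e n :
  \sum_(p <- cutwords n.+1 | (0 < p.1)%N == e) weight p =
  \sum_(l < n.+1) \sum_(q <- growths e n l)
    t ^+ (0 < l)%N * s ^+ ((0 < l) && (~~ e || (0 < q.1.1)))%N
      * (weight q.1 * weight q.2).
Proof.
rewrite -big_filter (perm_big _ (cutwords_grow e n)) big_allpairs_dep.
rewrite -[iota 0 n.+1]/(index_iota 0 n.+1) big_mkord.
by apply: eq_bigr => l _; apply: eq_big_seq => q; apply: weight_grow.
Qed.

Lemma cutwords0 : cutwords 0 = [:: (0%N, [::])].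
Proof. by []. Qed.

Lemma Bcoef0 : Bcoef 0 = 1.
Proof. by rewrite /Bcoef cutwords0 big_seq1 /weight !expr0 mulr1. Qed.

Lemma Ccoef0 : Ccoef 0 = 1.
Proof. by rewrite /Ccoef cutwords0 big_cons big_nil /weight /= mulr1 addr0. Qed.

Lemma BcoefE n : Bcoef n = Ccoef n + \sum_(p <- cutwords n | (0 < p.1)%N) weight p.
Proof.
rewrite /Bcoef (bigID (fun p => p.1 == 0%N)) /=; congr (_ + _).
by apply: eq_bigl => p; rewrite lt0n.
Qed.

Definition growth_sum (e : bool) (n l : nat) : A :=
  \sum_(x <- cutwords l) \sum_(y <- cutwords (n - l) | growable e l (x, y))
    t ^+ (0 < l)%N * s ^+ ((0 < l) && (~~ e || (0 < x.1)))%N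
      * (weight x * weight y).

Lemma sum_growthsE e n :
  \sum_(p <- cutwords n.+1 | (0 < p.1)%N == e) weight p =
  \sum_(l < n.+1) growth_sum e n l.
Proof.
rewrite sum_growths; apply: eq_bigr => l _.
by rewrite big_filter big_mkcond big_allpairs; apply: eq_bigr => x _; rewrite -big_mkcond.
Qed.

Lemma growth_sum_false0 n : growth_sum false n 0 = Ccoef n.
Proof.
rewrite /growth_sum cutwords0 big_seq1 subn0.
by apply: eq_bigr => p _; rewrite /weight !expr0 !mul1r.
Qed.

Lemma growth_sum_falseS n l :
  growth_sum false n l.+1 = s * t * (Ccoef l.+1 * Bcoef (n - l.+1)).
Proof.
rewrite /growth_sum /Ccoef /Bcoef big_distrl mulr_sumr [RHS]big_mkcond.
apply: eq_bigr => x _; rewrite /growable /= andbT.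
case: (x.1 == 0%N); last by rewrite big_pred0.
by rewrite !mulr_sumr; apply: eq_bigr => y _; ring.
Qed.

(** The three terms stand for [L] empty, [L] with cut 0, where the cut of the result hides the
    inverse descent at the least letter of [L'], and [L] with a positive cut. *)
Lemma growth_sum_true n l : growth_sum true n l =
  ((l == 0%N)%:R + t * (if l == 0%N then 0 else Ccoef l)
     + s * t * (Bcoef l - Ccoef l)) * Bcoef (n - l).
Proof.
case: l => [|l].
  rewrite Bcoef0 Ccoef0 subrr !mulr0 !addr0 mul1r subn0.
  rewrite /growth_sum cutwords0 big_seq1 subn0.
  by apply: eq_bigr => p _; rewrite /weight !expr0 !mul1r.
rewrite /= add0r (BcoefE l.+1) addrAC subrr add0r mulrDl -!mulrA.
rewrite /growth_sum (bigID (fun p => p.1 == 0%N)) /= /Ccoef /Bcoef.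
congr (_ + _); rewrite big_distrl !mulr_sumr /=.
  apply: eq_bigr => x /eqP->. rewrite !mulr_sumr; apply: eq_bigr => y _.
  by rewrite /=; ring.
apply: eq_big => [x|x]; first by rewrite lt0n.
rewrite -lt0n => ->; rewrite !mulr_sumr; apply: eq_bigr => y _.
by rewrite /=; ring.
Qed.

(** The equation [S = z (1 + S + s t S B)]; the summand [Ccoef n] comes from an empty [L], for which
    [R] has cut 0. *)
Lemma CcoefS n : Ccoef n.+1 = Ccoef n + s * t *
  \sum_(l < n.+1) (if l == 0%N :> nat then 0 else Ccoef l) * Bcoef (n - l).
Proof.
rewrite {1}/Ccoef (eq_bigl (fun p => (0 < p.1)%N == false)); last first.
  by move=> p; rewrite lt0n; case: eqP.
rewrite sum_growthsE !big_ord_recl growth_sum_false0 mul0r add0r mulr_sumr.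
by congr (_ + _); apply: eq_bigr => l _; rewrite growth_sum_falseS.
Qed.

Lemma BcoefS n : Bcoef n.+1 = Ccoef n.+1 + \sum_(l < n.+1)
  ((l == 0%N :> nat)%:R + t * (if l == 0%N :> nat then 0 else Ccoef l)
     + s * t * (Bcoef l - Ccoef l)) * Bcoef (n - l).
Proof.
rewrite BcoefE (eq_bigl (fun p => (0 < p.1)%N == true)); last first.
  by move=> p; case: (0 < _)%N.
rewrite sum_growthsE; congr (_ + _).
by apply: eq_bigr => l _; rewrite growth_sum_true.
Qed.

End Weights.

(** * Permutations as words *)

Definition word n (pi : {perm 'I_n}) : seq nat :=
  [seq val (pi i) | i <- enum 'I_n].

Lemma size_word n (pi : {perm 'I_n}) : size (word pi) = n.
Proof. by rewrite size_map size_enum_ord. Qed.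

Lemma nth_word n (pi : {perm 'I_n}) (i : 'I_n) : nth 0 (word pi) i = pi i.
Proof. by rewrite (nth_map i) ?size_enum_ord // nth_ord_enum. Qed.

Lemma word_perm n (pi : {perm 'I_n}) : perm_eq (word pi) (iota 0 n).
Proof.
apply/iota_permP; split; [|exact: size_word|by move=> v /mapP[i _ ->]; apply: ltn_ord].
by rewrite map_inj_uniq ?enum_uniq // => i j /val_inj/perm_inj.
Qed.

Lemma index_word n (pi : {perm 'I_n}) (v : 'I_n) :
  index (v : nat) (word pi) = ((pi^-1)%g v).
Proof.
have [uw _ _] := iota_permP _ _ (word_perm pi).
have {1}-> : v = nth 0 (word pi) (pi^-1 v)%g :> nat by rewrite nth_word permKV.
by rewrite index_uniq ?size_word.
Qed.

Lemma word_inj n : injective (@word n).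
Proof.
by move=> pi rho E; apply/permP => i; apply: ord_inj; rewrite -!nth_word E.
Qed.

Lemma words_perm n :
  perm_eq [seq word pi | pi <- index_enum {perm 'I_n}] (permutations (iota 0 n)).
Proof.
have uw : uniq [seq word pi | pi <- index_enum {perm 'I_n}].
  by rewrite map_inj_uniq ?index_enum_uniq //; apply: word_inj.
apply: uniq_perm => //; first exact: permutations_uniq.
have sub : {subset [seq word pi | pi <- index_enum {perm 'I_n}] <= permutations (iota 0 n)}.
  by move=> _ /mapP[pi _ ->]; rewrite mem_permutations word_perm.
have [|//] := uniq_min_size uw sub.
rewrite size_map size_permutations ?iota_uniq // size_iota -card_Sn cardE.
rewrite (@perm_size _ _ (index_enum {perm 'I_n})) //.
apply: uniq_perm; rewrite ?enum_uniq ?index_enum_uniq // => pi.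
by rewrite mem_enum mem_index_enum.
Qed.

Lemma wdesE w : wdes w =
  \sum_(i < size w) ((i.+1 < size w) && (nth 0 w i.+1 < nth 0 w i)).
Proof.
elim: w => [|x w IH]; first by rewrite big_ord0.
by rewrite [LHS]/= IH big_ord_recl /=; case: w {IH} => [|y w] //=; rewrite ltnn.
Qed.

Lemma des_word n (pi : {perm 'I_n}) : des pi = wdes (word pi).
Proof.
rewrite wdesE size_word /des -sum1dep_card big_mkcond /=.
apply: eq_bigr => i _; case: ltnP => [ltin|lein] /=.
  rewrite (nth_word pi (Ordinal ltin)) nth_word.
  suff -> : [exists j : 'I_n, (val j == i.+1) && (pi j < pi i)] =
            (pi (Ordinal ltin) < pi i) by case: (_ < _).
  apply/existsP/idP => [[j /andP[/eqP Ej lt]]|lt].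
    by rewrite (_ : Ordinal ltin = j) //; apply: val_inj.
  by exists (Ordinal ltin); rewrite eqxx.
case: existsP => // -[j /andP[/eqP Ej _]].
by have := ltn_ord j; rewrite Ej ltnNge lein.
Qed.

Lemma ides_word n (pi : {perm 'I_n}) : ides pi = cut_ides 0 (word pi).
Proof.
rewrite /ides des_word wdesE size_word /cut_ides.
rewrite (seq.permP (word_perm pi)) -sum1_count [RHS]big_mkcond.
case: n pi => [|m] pi; first by rewrite big_ord0 big_nil.
(* A pair of consecutive values is indexed by the lower one on the left and by the upper one on the
   right, so the last term is split off there and the first here. *)
rewrite -[iota 0 m.+1]/(index_iota 0 m.+1) big_mkord [RHS]big_ord_recl [LHS]big_ord_recr /=.
rewrite ltnn addn0 add0n; apply: eq_bigr => i _.
have Hi : (i : nat).+1 < m.+1 by rewrite ltnS ltn_ord.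
rewrite /= /bump leq0n add1n /= Hi.
rewrite (nth_word _ (Ordinal Hi)) (nth_word _ (widen_ord (leqnSn m) i)).
rewrite -!index_word /=; by case: (_ < _).
Qed.

(** The positions [p], [q], [r], [u] carry the 2, 4, 1, 3; with [p] and [q] in either order this
    covers both patterns. *)
Definition occurs n (pi : {perm 'I_n}) := exists p q r u : 'I_n,
  [/\ p < r, q < r, r < u & [&& pi r < pi p, pi p < pi u & pi u < pi q]].

Lemma contains_occurs n (pi : {perm 'I_n}) :
  contains_pattern pi [:: 2; 4; 1; 3] || contains_pattern pi [:: 4; 2; 1; 3]
  <-> occurs pi.
Proof.
split.
  case/orP => /existsP[f /forallP H].
    have {}H a b := forallP (H a) b.
    pose o k (hk : k < 4) : 'I_(size [:: 2; 4; 1; 3]) := Ordinal hk.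
    exists (f (o 0 isT)), (f (o 1 isT)), (f (o 2 isT)), (f (o 3 isT)).
    have := H (o 0 isT) (o 2 isT); have := H (o 1 isT) (o 2 isT).
    have := H (o 2 isT) (o 3 isT); have := H (o 2 isT) (o 0 isT).
    have := H (o 0 isT) (o 3 isT); have := H (o 3 isT) (o 1 isT).
    by move=> /= /eqP-> /andP[_ /eqP->] /eqP-> /andP[-> _] /andP[-> _] /andP[-> _].
  have {}H a b := forallP (H a) b.
  pose o k (hk : k < 4) : 'I_(size [:: 4; 2; 1; 3]) := Ordinal hk.
  exists (f (o 1 isT)), (f (o 0 isT)), (f (o 2 isT)), (f (o 3 isT)).
  have := H (o 0 isT) (o 2 isT); have := H (o 1 isT) (o 2 isT).
  have := H (o 2 isT) (o 3 isT); have := H (o 2 isT) (o 1 isT).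
  have := H (o 1 isT) (o 3 isT); have := H (o 3 isT) (o 0 isT).
  by move=> /= /eqP-> /andP[_ /eqP->] /eqP-> /andP[-> _] /andP[-> _] /andP[-> _].
case=> p [q [r [u [pr qr ru /and3P[rp pu uq]]]]].
have [pq|qp|pq] := ltngtP p q.
- apply/orP; left; apply/existsP.
  exists [ffun a : 'I_(size [:: 2; 4; 1; 3]) => nth p [:: p; q; r; u] a].
  apply/forallP => -[[|[|[|[|a]]]] //= ha]; apply/forallP => -[[|[|[|[|b]]]] //= hb];
    rewrite !ffunE /=; lia.
- apply/orP; right; apply/existsP.
  exists [ffun a : 'I_(size [:: 4; 2; 1; 3]) => nth p [:: q; p; r; u] a].
  apply/forallP => -[[|[|[|[|a]]]] //= ha]; apply/forallP => -[[|[|[|[|b]]]] //= hb];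
    rewrite !ffunE /=; lia.
- by move: pu uq; rewrite (val_inj pq); lia.
Qed.

Lemma avoids_word n (pi : {perm 'I_n}) :
  avoids_2413_4213b pi = cut_avoiding 0 (word pi).
Proof.
rewrite /avoids_2413_4213b /avoids -negb_or.
apply/idP/idP.
  move=> /negP H; apply/cut_avoidingP; rewrite size_word; split=> //.
  move=> a b x d xa ad db ax bx xd dn; apply: H; apply/contains_occurs.
  have lt v : index v (word pi) < n -> v < n.
    by rewrite (iota_perm_index v (word_perm pi)).
  have dn' : d < n by apply: lt.
  have xn : x < n by apply: lt; lia.
  have an : a < n by apply: lt; lia.
  have bn : b < n by apply: lt; lia.
  move: ax bx xd; rewrite (index_word pi (Ordinal an)) (index_word pi (Ordinal bn)).
  rewrite (index_word pi (Ordinal xn)) (index_word pi (Ordinal dn')) => ax bx xd.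
  exists (pi^-1 (Ordinal an))%g, (pi^-1 (Ordinal bn))%g,
    (pi^-1 (Ordinal xn))%g, (pi^-1 (Ordinal dn'))%g.
  by split=> //; rewrite !permKV /=; apply/and3P.
move=> /cut_avoidingP; rewrite size_word => -[H _ _].
apply/negP => /contains_occurs[p [q [r [u [pr qr ru /and3P[rp pu uq]]]]]].
by apply: (H (pi p) (pi q) (pi r) (pi u)); rewrite // !index_word ?permK.
Qed.

Lemma Scoef_words (R : comNzRingType) (s t : R) n :
  Scoef s t n = if n == 0 then 0%R else Ccoef s t n.
Proof.
rewrite /Scoef; case: ifP => // _; rewrite /Ccoef /cutwords.
rewrite big_filter_cond [RHS]big_mkcond big_allpairs -[iota 0 n.+1]/(0 :: iota 1 n).
rewrite big_cons /= [X in (_ + X)%R]big1_seq ?addr0; last first.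
  move=> c; rewrite mem_iota => /andP[_ /andP[c0 _]]; apply: big1 => w _.
  by rewrite andbC eqn0Ngt c0.
rewrite -(perm_big _ (words_perm n)) big_map big_mkcond.
apply: eq_bigr => pi _.
by rewrite avoids_word /weight /= andbT ides_word des_word.
Qed.

(** * Elimination modulo a power of the variable *)

Local Open Scope ring_scope.

Section Truncated.
Variables (R : comNzRingType) (N : nat).
Implicit Types (a b : nat -> R) (p q : {poly R}).

(** Replacing series by polynomials up to degree [N] makes [ring] available for the elimination. *)
Definition agree a p := forall i, (i <= N)%N -> a i = p`_i.

Definition trunc a : {poly R} := \poly_(i < N.+1) a i.

Lemma coef_trunc a i : (i <= N)%N -> (trunc a)`_i = a i.
Proof. by move=> iN; rewrite coef_poly ltnS iN. Qed.

Lemma agree_trunc a : agree a (trunc a).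
Proof. by move=> i iN; rewrite coef_trunc. Qed.

Lemma agree_mul a b p q : agree a p -> agree b q -> agree (fps_mul a b) (p * q).
Proof.
move=> ap bq i iN; rewrite coefM; apply: eq_bigr => j _.
by rewrite ap ?bq //; have := ltn_ord j; lia.
Qed.

Lemma agree_z a p : agree a p -> agree (fps_z a) ('X * p).
Proof. by move=> ap [|i] iN; rewrite coefXM //= ap // ltnW. Qed.

Lemma agree_zvar : agree (@fps_zvar R) 'X.
Proof. by move=> i _; rewrite coefX /fps_zvar; case: eqP. Qed.

Lemma coef_eq_modXn p q : (forall i, (i <= N)%N -> p`_i = q`_i) ->
  exists r, p = q + r * 'X^(N.+1).
Proof.
move=> H; exists (drop_poly N.+1 (p - q)).
rewrite -[LHS](subrK q) addrC -[p - q in LHS](poly_take_drop N.+1).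
congr (_ + _); rewrite [take_poly _ _](_ : _ = 0) ?add0r //.
apply/polyP => i; rewrite coef_take_poly coef0; case: ifP => // iN.
by rewrite coefB H ?subrr.
Qed.

(** If ['X^j] divides [D], the right-hand side gains a further factor ['X], so divisibility climbs
    up to ['X^(N.+1)]. *)
Lemma contracting_modXn (D K E : {poly R}) :
  D = 'X * K * D + E * 'X^(N.+1) -> exists F, D = F * 'X^(N.+1).
Proof.
move=> H; have {}H : D = 'X * (K * D) + E * 'X^(N.+1) by rewrite {1}H mulrA.
suff: forall j, (j <= N.+1)%N -> exists F, D = F * 'X^j by apply.
elim=> [|j IH] jN; first by exists D; rewrite mulr1.
have [F HF] := IH (ltnW jN); exists (K * F + E * 'X^(N - j)).
rewrite {1}H {1}HF.
have -> : 'X^(N.+1) = 'X^(N - j) * 'X^(j.+1) :> {poly R}.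
  by rewrite -exprD addnS subnK.
rewrite exprS; ring.
Qed.

Lemma cubic_of_system (u v S B r1 r2 : {poly R}) :
  S = 'X * (1 + S + u * v * (S * B)) + r1 * 'X^(N.+1) ->
  B = 1 + S + 'X * ((1 + v * S + u * v * (B - (1 + S))) * B) + r2 * 'X^(N.+1) ->
  exists r, S = v * ((u - 1) * ('X * (S * S * S)) + S * S * S)
    + v * (2%:R * u - 1) * ('X * (S * S)) + (v * u + 1) * ('X * S) + 'X
    + r * 'X^(N.+1).
Proof.
(* [D] is fixed by a multiple of ['X] up to the truncation, hence vanishes. *)
move=> E1 E2; pose D := B * (1 - v * (S * S)) - (1 + S) * (1 + S).
have {}E1 : S - ('X * (1 + S + u * v * (S * B)) + r1 * 'X^(N.+1)) = 0.
  by apply/eqP; rewrite subr_eq0; apply/eqP.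
have {}E2 : B - (1 + S + 'X * ((1 + v * S + u * v * (B - (1 + S))) * B)
    + r2 * 'X^(N.+1)) = 0.
  by apply/eqP; rewrite subr_eq0; apply/eqP.
have [F HF] : exists F, D = F * 'X^(N.+1).
  apply: (@contracting_modXn D (1 + v * S + u * v * B)
    (r2 * (1 - v * (S * S)) - (1 + S) * (1 + v * S) * r1)).
  apply/eqP; rewrite -subr_eq0; apply/eqP.
  (* The equation for [B] times [1 - v * (S * S)], minus the equation for [S] times
     [(1 + S) * (1 + v * S)], is the relation for [D]. *)
  transitivity ((1 - v * (S * S)) * 0 - (1 + S) * (1 + v * S) * (0 : {poly R}));
    last by rewrite !mulr0 subr0.
  by rewrite -{1}E2 -E1 /D; ring.
(* Once the equation for [S] is multiplied by [1 - v * (S * S)], [B] occurs only through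
   [B * (1 - v * (S * S))], which is [(1 + S) * (1 + S) + D]. *)
exists (u * v * 'X * S * F + r1 * (1 - v * (S * S))).
rewrite [X in _ + X](_ : _ = u * v * 'X * S * D
  + r1 * (1 - v * (S * S)) * 'X^(N.+1)); last by rewrite HF; ring.
apply/eqP; rewrite -subr_eq0; apply/eqP.
transitivity ((1 - v * (S * S)) * (0 : {poly R})); last by rewrite mulr0.
by rewrite -E1 /D; ring.
Qed.

(* At [v = 1] the cubic is the quadratic times [1 + S], which is invertible. *)
Lemma quadratic_of_cubic (u S r : {poly R}) : S`_0 = 0 ->
  S = ((u - 1) * ('X * (S * S * S)) + S * S * S)
    + (2%:R * u - 1) * ('X * (S * S)) + (u + 1) * ('X * S) + 'X
    + r * 'X^(N.+1) ->
  exists r', S = u * ('X * (S * S)) - 'X * (S * S) + S * S + u * ('X * S) + 'X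
    + r' * 'X^(N.+1).
Proof.
move=> S0 E.
have [T ST] : exists T, S = 'X * T.
  exists (drop_poly 1 S); rewrite -[LHS](poly_take_drop 1) mulrC.
  rewrite [take_poly _ _](_ : _ = 0) ?add0r //.
  by apply/polyP => -[|i]; rewrite coef_take_poly coef0.
pose Q := S - (u * ('X * (S * S)) - 'X * (S * S) + S * S + u * ('X * S) + 'X).
have [F HF] : exists F, Q = F * 'X^(N.+1).
  (* The cubic reads [(1 + S) * Q = r * 'X^(N.+1)], that is [Q = - S * Q + r * 'X^(N.+1)] with
     [S = 'X * T]. *)
  apply: (@contracting_modXn Q (- T) r).
  rewrite mulrN -ST; apply/eqP; rewrite -subr_eq0; apply/eqP.
  move/eqP: E; rewrite -subr_eq0 => /eqP <-; rewrite /Q; ring.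
by exists F; rewrite -HF /Q; ring.
Qed.

End Truncated.

(** * The system for [S] and [B], and the cubic, in truncated form *)

Section Equation.
Variables (R : comNzRingType) (s t : R) (N : nat).

Local Notation S := (trunc N (Scoef s t)).
Local Notation B := (trunc N (Bcoef s t)).

Lemma coef_1S i : (i <= N)%N -> (1 + S)`_i = Ccoef s t i.
Proof.
move=> iN; rewrite coefD coef1 coef_trunc // Scoef_words.
by case: i iN => [|i] iN /=; rewrite ?Ccoef0 ?addr0 ?add0r.
Qed.

Lemma S_eq : exists r, S = 'X * (1 + S + (s * t)%:P * (S * B)) + r * 'X^(N.+1).
Proof.
apply: coef_eq_modXn => -[|i] iN; rewrite coefXM coef_trunc //=.
rewrite coefD coef_1S ?(ltnW iN) // coefCM coefM Scoef_words /= CcoefS.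
congr (_ + _ * _); apply: eq_bigr => l _; have := ltn_ord l => ll.
by rewrite coef_trunc ?coef_trunc ?Scoef_words //; lia.
Qed.

Lemma B_eq : exists r, B = 1 + S
  + 'X * ((1 + t%:P * S + (s * t)%:P * (B - (1 + S))) * B) + r * 'X^(N.+1).
Proof.
apply: coef_eq_modXn => -[|i] iN; rewrite coefD coefXM coef_1S // coef_trunc //=.
  by rewrite Bcoef0 Ccoef0 addr0.
rewrite BcoefS coefM; congr (_ + _); apply: eq_bigr => l _.
have := ltn_ord l => ll.
have lN : (l <= N)%N by lia.
have lN' : (i - l <= N)%N by lia.
rewrite !coefD coef1 !coefCM coefB coef_trunc // coef_1S // coef_trunc // coef_trunc //.
by rewrite Scoef_words.
Qed.

Lemma S_cubic : exists r,
  S = t%:P * ((s%:P - 1) * ('X * (S * S * S)) + S * S * S)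
    + t%:P * (2%:R * s%:P - 1) * ('X * (S * S)) + (t%:P * s%:P + 1) * ('X * S)
    + 'X + r * 'X^(N.+1).
Proof.
have [r1 E1] := S_eq; have [r2 E2] := B_eq.
by apply: cubic_of_system; rewrite -!polyCM; [exact: E1 | exact: E2].
Qed.

End Equation.

Theorem theorem4p4 :
  (forall (R : comNzRingType) (s t : R) (n : nat),
    let S := Scoef s t in
    let S2 := fps_mul S S in
    let S3 := fps_mul S2 S in
    S n = t * ((s - 1) * fps_z S3 n + S3 n)
          + t * (2%:R * s - 1) * fps_z S2 n
          + (t * s + 1) * fps_z S n
          + fps_zvar R n)
  /\
  (forall (R : comNzRingType) (t : R) (n : nat),
    let S := Scoef 1 t in
    let S2 := fps_mul S S in
    let S3 := fps_mul S2 S in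
    S n = t * S3 n + t * fps_z S2 n + (t + 1) * fps_z S n + fps_zvar R n)
  /\
  (forall (R : comNzRingType) (s : R) (n : nat),
    let S := Scoef s 1 in
    let S2 := fps_mul S S in
    S n = (s * fps_z S2 n - fps_z S2 n + S2 n) + s * fps_z S n + fps_zvar R n).
Proof.
have cubic : forall (R : comNzRingType) (s t : R) (n : nat),
    let S := Scoef s t in
    let S2 := fps_mul S S in
    let S3 := fps_mul S2 S in
    S n = t * ((s - 1) * fps_z S3 n + S3 n)
          + t * (2%:R * s - 1) * fps_z S2 n
          + (t * s + 1) * fps_z S n
          + fps_zvar R n.
  (* Truncating at [N = n] suffices for the coefficient of degree [n], to which the multiple of
     ['X^(n.+1)] contributes 0. *)
  move=> R s t n S S2 S3; have [r E] := S_cubic s t n.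
  have agS := @agree_trunc R n (Scoef s t); have agS2 := agree_mul agS agS.
  have agS3 := agree_mul agS2 agS.
  rewrite [LHS](agS n) // {1}E !(agree_z agS3, agree_z agS2, agree_z agS) //.
  rewrite (@agree_zvar R n n) // coefD coefMXn ltnSn addr0.
  have -> : s%:P - 1 = (s - 1)%:P by rewrite rmorphB rmorph1.
  have -> : t%:P * (2%:R * s%:P - 1) = (t * (2%:R * s - 1))%:P.
    by rewrite rmorphM rmorphB rmorphM rmorph1 rmorph_nat.
  have -> : t%:P * s%:P + 1 = (t * s + 1)%:P by rewrite rmorphD rmorphM rmorph1.
  by rewrite !(coefD, coefCM) -agS3.
split=> //; split=> [R t n S S2 S3|R s n S S2].
  by rewrite /S cubic subrr mul0r add0r mulr1 -/S -/S2 -/S3; ring.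
have [r E] : exists r, trunc n S = s%:P * ('X * (trunc n S * trunc n S))
    - 'X * (trunc n S * trunc n S) + trunc n S * trunc n S
    + s%:P * ('X * trunc n S) + 'X + r * 'X^(n.+1).
  have [r] := S_cubic s 1 n; rewrite polyC1 !mul1r => E.
  by apply: quadratic_of_cubic E; rewrite coef_trunc.
have agS := @agree_trunc R n (Scoef s 1); have agS2 := agree_mul agS agS.
rewrite [LHS](agS n) // {1}E (agree_z agS2) // (agree_z agS) //.
by rewrite (@agree_zvar R n n) // coefD coefMXn ltnSn addr0 !(coefD, coefN, coefCM) -agS2.
Qed.
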